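(* Let $q=p^n$ be a power of an odd prime $p$ with $q\equiv3\pmod4$, and let $\Gamma^3=\{(\boldsymbol\xi,\tau,\sigma)\in\mathbb F_q^2\times\mathbb F_q\times\mathbb F_q:\tau\sigma=\boldsymbol\xi\cdot\boldsymbol\xi\}\setminus\{\mathbf 0\}\subset\mathbb F_q^4$ be equipped with its normalized surface measure $\nu$. Then $$\mathbf R^*_{\Gamma^3}(2\to4)=(1-2q^{-1}+2q^{-2}-3q^{-4}+3q^{-5})^{1/4}(1-q^{-1})^{-3/4}(1+q^{-2})^{-3/4}.$$ In other words, the inequality $$\|(f\nu)^\vee\|_{L^4(\mathbb F_q^4,\mathrm d\boldsymbol x)}^4\le\frac{q^4(q^5-2q^4+2q^3-3q+3)}{(q-1)^3(q^2+1)^3}\|f\|_{L^2(\Gamma^3,\mathrm d\nu)}^4$$ holds for all $f:\Gamma^3\to\mathbb C$ and is sharp (the constant is best possible), and equality holds if $f:\Gamma^3\to\mathbb C$ is a constant function. Moreover, any maximizer $f$ of this inequality has constant modulus, i.e. $|f|$ is constant on $\Gamma^3$.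
   Context: $\mathbb F_q$ is the finite field with $q$ elements and $e:\mathbb F_q\to\mathbb S^1\subset\mathbb C$ is a fixed nontrivial additive character. For $\boldsymbol x,\boldsymbol\xi\in\mathbb F_q^d$, $\boldsymbol x\cdot\boldsymbol\xi=\sum_i x_i\xi_i$. For a nonempty set $S\subset\mathbb F_q^d$ (frequency space $\mathbb F_q^{d*}$ is identified with $\mathbb F_q^d$) with normalized surface measure $\nu$ (uniform probability measure on $S$) and $f:S\to\mathbb C$, the extension operator is $$(f\nu)^\vee(\boldsymbol x)=\frac1{|S|}\sum_{\boldsymbol\xi\in S}f(\boldsymbol\xi)e(\boldsymbol x\cdot\boldsymbol\xi),\quad \boldsymbol x\in\mathbb F_q^d.$$ Norms: $\|f\|_{L^r(S,\mathrm d\nu)}=\big(\frac1{|S|}\sum_{\boldsymbol\xi\in S}|f(\boldsymbol\xi)|^r\big)^{1/r}$ and $\|g\|_{L^r(\mathbb F_q^d,\mathrm d\boldsymbol x)}=\big(\sum_{\boldsymbol x\in\mathbb F_q^d}|g(\boldsymbol x)|^r\big)^{1/r}$ (counting measure). $\mathbf R^*_S(r\to s)$ denotes the best (smallest) constant for which $\|(f\nu)^\vee\|_{L^s(\mathbb F_q^d,\mathrm d\boldsymbol x)}\le\mathbf R^*_S(r\to s)\|f\|_{L^r(S,\mathrm d\nu)}$ holds for all $f:S\to\mathbb C$. A maximizer is a not identically zero function $f:S\to\mathbb C$ for which equality holds in the inequality with best constant. *)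

(* Defs.v *)
From HB Require Import structures.
From mathcomp Require Import all_boot all_order all_algebra.
From mathcomp Require Import complex.
From mathcomp Require Import all_classical all_reals all_analysis.

Set Implicit Arguments.
Unset Strict Implicit.
Unset Printing Implicit Defensive.

Import Order.TTheory GRing.Theory Num.Theory.
Local Open Scope ring_scope.
Local Open Scope complex_scope.

(* The real-valued modulus; the library norm `|z| on R[i] takes values in R[i]. *)
Definition modulus (R : realType) (z : R[i]) : R := ComplexField.Normc.normc z.

Definition dot (F : finFieldType) (d : nat) (x y : 'rV[F]_d) : F :=
  \sum_(i < d) x 0 i * y 0 i.

Definition nontrivial_additive_character (R : realType) (F : finFieldType)
    (e : F -> R[i]) : Prop :=
  [/\ forall a b, e (a + b) = e a * e b,
      forall a, modulus (e a) = 1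
    & exists a, e a != 1].

Definition extension (R : realType) (F : finFieldType) (e : F -> R[i])
    (d : nat) (S : {set 'rV[F]_d}) (f : {xi | xi \in S} -> R[i])
    (x : 'rV[F]_d) : R[i] :=
  (#|S|%:R)^-1 * \sum_(xi : {xi | xi \in S}) f xi * e (dot x (val xi)).

Definition surface_norm (R : realType) (F : finFieldType) (d : nat)
    (S : {set 'rV[F]_d}) (r : R) (f : {xi | xi \in S} -> R[i]) : R :=
  ((#|S|%:R)^-1 * \sum_(xi : {xi | xi \in S}) modulus (f xi) `^ r) `^ r^-1.

Definition counting_norm (R : realType) (F : finFieldType) (d : nat)
    (s : R) (g : 'rV[F]_d -> R[i]) : R :=
  (\sum_(x : 'rV[F]_d) modulus (g x) `^ s) `^ s^-1.

(* For nonempty S the set below is nonempty, bounded below by 0 and closed,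
   so this infimum is its minimum. *)
Definition best_constant (R : realType) (F : finFieldType) (e : F -> R[i])
    (d : nat) (S : {set 'rV[F]_d}) (r s : R) : R :=
  inf [set C : R | forall f : {xi | xi \in S} -> R[i],
         counting_norm s (extension e f) <= C * surface_norm r f]%classic.

Definition maximizer (R : realType) (F : finFieldType) (e : F -> R[i])
    (d : nat) (S : {set 'rV[F]_d}) (r s : R) (f : {xi | xi \in S} -> R[i])
    : Prop :=
  (exists xi, f xi != 0) /\
  counting_norm s (extension e f) = best_constant e S r s * surface_norm r f.

(* A point of F^4 is read as (xi, tau, sigma): xi is the left half, and
   (tau, sigma) is the right half. *)
Definition cone3 (F : finFieldType) : {set 'rV[F]_(2 + 2)} :=
  [set z : 'rV[F]_(2 + 2) |
    rsubmx z 0 0 * rsubmx z 0 1 == dot (lsubmx z) (lsubmx z)] :\ 0.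

(* Main.v *)
Require Import Defs.
From mathcomp Require Import all_boot all_order all_algebra.
From mathcomp Require Import complex.
From mathcomp Require Import all_classical all_reals all_analysis.
From mathcomp Require Import fingroup cyclic finfield ring lra zify.

Set Implicit Arguments.
Unset Strict Implicit.
Unset Printing Implicit Defensive.

Import Order.TTheory GRing.Theory Num.Theory.
Local Open Scope ring_scope.
Local Open Scope complex_scope.

(* By Parseval, ||(f nu)^v||_4^4 = q^4 / |S|^4 * sum_z |(f * f)(z)|^2.  Since -1
   is not a square, xi.xi is anisotropic and the cone is the disjoint union of
   q^2 + 1 punctured lines l, no two of which are orthogonal.  With M the total
   of |f|^2, m_l its total on l and P_l = sum_{a in l} |f(a) f(-a)| <= m_l, the
   terms of the energy are estimated as follows:
   - at z = 0, |(f * f)(0)| <= sum_l P_l;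
   - z on the line l is only a sum of two points of l, in q - 2 ways, so by
     Cauchy-Schwarz l contributes at most
     (q - 2) (m_l^2 - sum_{a in l} |f(a) f(-a)|^2)
       <= (q - 2) (m_l^2 - P_l^2 / (q - 1));
   - an anisotropic z is a sum of two points of the cone in exactly q^2 - q
     ways, so these z contribute at most (q^2 - q) (M^2 - sum_l m_l^2).
   The resulting bound increases with P_l, so P_l may be replaced by m_l; what
   remains is a negative multiple of sum_l m_l^2 plus a multiple of M^2, and
   sum_l m_l^2 >= M^2 / (q^2 + 1).  All steps are equalities for constant f.
   Conversely, equality forces |f(a)| = |f(-a)|, then |f(a) f(-a)| constant on
   each line, and all m_l equal, whence |f| is constant. *)

(** * Sums of two squares and isotropic lines *)

Lemma card_line (F : finFieldType) (x y c : F) : ~~ ((x == 0) && (y == 0)) ->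
  #|[set w : F * F | x * w.1 + y * w.2 == c]| = #|F|.
Proof.
rewrite -cardsT negb_and.
have [->|x0 _] /= := eqVneq x 0 => [y0|].
  rewrite -(card_imset finset.setT (_ : injective (fun v => (v, c / y))))
    => [|v v' []//].
  congr #|pred_of_set _|; apply/setP => -[v w]; rewrite inE mul0r add0r /=.
  apply/eqP/imsetP => [<-|[_ _ [_ ->]]]; last by field.
  by exists v => //; congr pair; field.
rewrite -(card_imset finset.setT (_ : injective (fun v => ((c - y * v) / x, v))))
  => [|v v' []//].
congr #|pred_of_set _|; apply/setP => -[v w]; rewrite inE /=.
apply/eqP/imsetP => [<-|[u _ [-> ->]]]; last by field.
by exists w => //; congr pair; field.
Qed.

Section SumsOfTwoSquares.
Variable F : finFieldType.
Hypothesis sqr_neqN1 : forall x : F, x ^+ 2 != -1.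

Lemma two_neq0 : (2 : F) != 0.
Proof.
apply/eqP => two0; move/eqP: (sqr_neqN1 1); apply.
by apply/eqP; rewrite expr1n -addr_eq0 -mulr2n two0.
Qed.

(** With [y] nonzero, [x ^+ 2 = - y ^+ 2] would make [x / y] a square root of -1. *)
Lemma sum_sqr_eq0 (x y : F) : (x ^+ 2 + y ^+ 2 == 0) = (x == 0) && (y == 0).
Proof.
apply/idP/andP => [/eqP s0|[/eqP-> /eqP->]]; last by rewrite expr0n addr0.
have [y0|y0] := eqVneq y 0.
  by move: s0; rewrite y0 expr0n addr0 => /eqP; rewrite sqrf_eq0.
case/eqP: (sqr_neqN1 (x / y)); rewrite expr_div_n.
by have -> : x ^+ 2 = - y ^+ 2 by [apply/eqP; rewrite -addr_eq0 s0]; field.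
Qed.

(** Squaring has one preimage over 0 and at most two over any other square. *)
Lemma card_sqr_le : (#|F| < (#|[set x ^+ 2 | x : F]|).*2)%N.
Proof.
pose S := [set x ^+ 2 | x : F].
have S0 : 0 \in S by apply/imsetP; exists 0; rewrite ?expr0n.
have -> : #|F| = (\sum_(c in S) #|[set x : F | x ^+ 2 == c]|)%N.
  rewrite -sum1_card (partition_big (fun x => x ^+ 2) [in S]) /= => [|x _].
    by apply: eq_bigr => c _; rewrite sum1dep_card.
  by apply/imsetP; exists x.
rewrite (bigD1 0) //= (_ : [set x | _] = [set 0]); last first.
  by apply/setP => x; rewrite !inE sqrf_eq0.
rewrite cards1 (cardsD1 0 S) S0; set A := (\sum_(i in _ | _) _)%N.
suff: (A <= #|S :\ (0%R : F)| * 2)%N.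
  by set k := #|_|; rewrite -muln2 -ltnS /= => ?; lia.
rewrite {}/A -sum_nat_const.
rewrite (eq_bigl [in S :\ 0]) => [|c]; last by rewrite !inE andbC.
apply: leq_sum => c /setD1P[_ /imsetP[x _ ->]].
rewrite -[leqRHS]/(size [:: x; - x]).
apply: leq_trans (card_size _); apply: subset_leq_card.
by apply/fintype.subsetP => y; rewrite !inE eqf_sqr.
Qed.

(** Pigeonhole: the squares, and their images under x -> c - x, each fill more than half of the
    field. *)
Lemma sum_sqr_surj (c : F) : exists w : F * F, w.1 ^+ 2 + w.2 ^+ 2 = c.
Proof.
pose S := [set x ^+ 2 | x : F]; pose S' := [set c - x | x in S].
have cS' : #|S'| = #|S| by rewrite card_imset // => x y /addrI /oppr_inj.
have [/pred0P S0|] := boolP [disjoint S & S'].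
  have := card_sqr_le; rewrite -/S -addnn -{2}cS' -cardsUI.
  rewrite [X in (_ + X)%N](_ : _ = 0%N) ?addn0 ?ltnNge ?max_card //.
  by apply/eqP; rewrite cards_eq0; apply/eqP/setP => x; rewrite !inE; exact: S0.
rewrite disjoint_sym => /pred0Pn[_ /= /andP[/imsetP[_ /imsetP[x _ ->] ->]]].
by case/imsetP => y _ e; exists (x, y) => /=; rewrite -e subrKC.
Qed.

(** All circles of nonzero level have the same size k and level 0 is the origin alone, so q^2 = 1 +
    (q - 1) k. *)
Lemma card_circle (c : F) :
  c != 0 -> #|[set w : F * F | w.1 ^+ 2 + w.2 ^+ 2 == c]| = #|F|.+1.
Proof.
pose circ (c : F) := [set w : F * F | w.1 ^+ 2 + w.2 ^+ 2 == c].
have circ1 d : d != 0 -> #|circ d| = #|circ 1|.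
  move=> d0; have [[a b] /= dE] := sum_sqr_surj d.
  (* Reading w as w.1 + i w.2, [h] multiplies by a + i b, of norm d, and [h'] by its conjugate
     divided by d. *)
  pose h (w : F * F) := (a * w.1 - b * w.2, a * w.2 + b * w.1).
  pose h' (w : F * F) := ((a * w.1 + b * w.2) / d, (a * w.2 - b * w.1) / d).
  have hK : cancel h h'.
    move=> [x y]; rewrite /h' /h -dE /=; move: d0; rewrite -dE => d0.
    by congr pair; field.
  have h'K : cancel h' h.
    move=> [x y]; rewrite /h' /h -dE /=; move: d0; rewrite -dE => d0.
    by congr pair; field.
  rewrite -(card_imset (circ 1) (can_inj hK)); congr #|pred_of_set _|.
  apply/setP => w; rewrite inE; apply/eqP/imsetP => [wd|[v]].
    exists (h' w); rewrite ?h'K // inE /=; apply/eqP.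
    rewrite -[LHS](_ : (a ^+ 2 + b ^+ 2) * (w.1 ^+ 2 + w.2 ^+ 2) / d ^+ 2 = _).
      by rewrite dE wd; field.
    by field.
  rewrite inE => /eqP v1 -> /=; rewrite -dE -[RHS]mulr1 -v1; ring.
move=> c0; rewrite -/(circ c) circ1 //.
have : (#|{: F * F}| = \sum_(d : F) #|circ d|)%N.
  rewrite -sum1_card (partition_big (fun w : F * F => w.1 ^+ 2 + w.2 ^+ 2) predT) //.
  by apply: eq_bigr => d _; rewrite sum1dep_card.
rewrite (bigD1 0) //= (eq_bigr (fun=> #|circ 1|)) => [|d]; last exact: circ1.
rewrite sum_nat_const card_prod cardC1.
have -> : #|circ 0| = 1%N.
  by rewrite -(cards1 (0 : F * F)); congr #|pred_of_set _|; apply/setP=> -[x y];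
    rewrite !inE sum_sqr_eq0.
have := finRing_gt1 F; set k := #|circ 1|; set m := #|F|; nia.
Qed.

End SumsOfTwoSquares.

(** * The cone, its isotropic lines, and sums of two cone points *)

Section Cone.
Variable F : finFieldType.
Implicit Types (z : 'rV[F]_(2 + 2)) (t u : F) (l : option (F * F)).

Definition mk4 (x y a b : F) : 'rV[F]_(2 + 2) :=
  row_mx (\row_j (if j == 0 then x else y)) (\row_j (if j == 0 then a else b)).

Definition qform z : F :=
  dot (lsubmx z) (lsubmx z) - rsubmx z 0 0 * rsubmx z 0 1.

(* The isotropic lines l are spanned by (x, y, x^2 + y^2, 1), encoded as
   [Some (x, y)], and by (0, 0, 1, 0), encoded as [None]. *)
Definition dir t l : 'rV[F]_(2 + 2) :=
  if l is Some (x, y) then mk4 (t * x) (t * y) (t * (x ^+ 2 + y ^+ 2)) t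
  else mk4 0 0 t 0.

(** Inverse of [dir] on the cone: the last coordinate is the parameter, unless it vanishes, which on
    the cone leaves only the line [None]. *)
Definition undir z : F * option (F * F) :=
  let s := rsubmx z 0 1 in
  if s == 0 then (rsubmx z 0 0, None)
  else (s, Some (lsubmx z 0 0 / s, lsubmx z 0 1 / s)).

Lemma mk4_lsub0 x y a b : lsubmx (mk4 x y a b) 0 0 = x.
Proof. by rewrite row_mxKl mxE. Qed.

Lemma mk4_lsub1 x y a b : lsubmx (mk4 x y a b) 0 1 = y.
Proof. by rewrite row_mxKl mxE. Qed.

Lemma mk4_rsub0 x y a b : rsubmx (mk4 x y a b) 0 0 = a.
Proof. by rewrite row_mxKr mxE. Qed.

Lemma mk4_rsub1 x y a b : rsubmx (mk4 x y a b) 0 1 = b.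
Proof. by rewrite row_mxKr mxE. Qed.

Definition mk4E := (mk4_lsub0, mk4_lsub1, mk4_rsub0, mk4_rsub1).

Lemma mk4_eta z :
  z = mk4 (lsubmx z 0 0) (lsubmx z 0 1) (rsubmx z 0 0) (rsubmx z 0 1).
Proof.
by rewrite -[LHS]hsubmxK; congr row_mx; apply/rowP => j; rewrite [RHS]mxE;
  case: ifP => [/eqP->//|]; case: j => [[|[|[]]]] // i _; congr (_ _ _);
  apply: val_inj.
Qed.

Lemma mk4_lin t x y a b x' y' a' b' :
  mk4 x y a b + t *: mk4 x' y' a' b' =
  mk4 (x + t * x') (y + t * y') (a + t * a') (b + t * b').
Proof.
by rewrite /mk4 scale_row_mx add_row_mx; congr row_mx; apply/rowP => j;
  rewrite !mxE; case: ifP.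
Qed.

Lemma mk4D x y a b x' y' a' b' :
  mk4 x y a b + mk4 x' y' a' b' = mk4 (x + x') (y + y') (a + a') (b + b').
Proof. by rewrite -[mk4 x' _ _ _]scale1r mk4_lin !mul1r. Qed.

Lemma mk4B x y a b x' y' a' b' :
  mk4 x y a b - mk4 x' y' a' b' = mk4 (x - x') (y - y') (a - a') (b - b').
Proof. by rewrite -scaleN1r mk4_lin !mulN1r. Qed.

Lemma mk4_0 : mk4 0 0 0 0 = 0.
Proof. by rewrite [RHS]mk4_eta; congr mk4; rewrite !mxE. Qed.

Lemma qform_mk4 x y a b : qform (mk4 x y a b) = x ^+ 2 + y ^+ 2 - a * b.
Proof.
rewrite /qform !mk4E /dot big_ord_recl big_ord1 (_ : lift _ _ = 1).
  by rewrite !mk4E -!expr2.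
exact: val_inj.
Qed.

Lemma in_cone3 z : (z \in cone3 F) = (qform z == 0) && (z != 0).
Proof. by rewrite !inE andbC eq_sym /qform subr_eq0. Qed.

Lemma dirD t u l : dir t l + dir u l = dir (t + u) l.
Proof.
by case: l => [[x y]|] /=; rewrite mk4D ?addr0 //; congr mk4; ring.
Qed.

Lemma dir0 l : dir 0 l = 0.
Proof. by case: l => [[x y]|] /=; rewrite ?mul0r mk4_0. Qed.

Lemma dirN t l : dir (- t) l = - dir t l.
Proof. by apply/eqP; rewrite -addr_eq0 dirD addNr dir0. Qed.

Lemma undirK t l : t != 0 -> undir (dir t l) = (t, l).
Proof.
move=> t0; rewrite /undir; case: l => [[x y]|] /=; rewrite !mk4E ?eqxx //.
by rewrite (negPf t0) ![t * _]mulrC !mulfK.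
Qed.

Lemma dir_eq0 t l : (dir t l == 0) = (t == 0).
Proof.
have [->|t0] := eqVneq t 0; first by rewrite dir0 eqxx.
apply/eqP => d0; have := undirK l t0; rewrite d0 -(dir0 None) /undir /= !mk4E.
by rewrite eqxx => -[/esym/eqP]; rewrite (negPf t0).
Qed.

Lemma qform_dir t l : qform (dir t l) = 0.
Proof. by case: l => [[x y]|] /=; rewrite qform_mk4; ring. Qed.

Lemma dir_cone t l : (dir t l \in cone3 F) = (t != 0).
Proof. by rewrite in_cone3 dir_eq0 qform_dir eqxx. Qed.

Hypothesis sqr_neqN1 : forall x : F, x ^+ 2 != -1.

(** If the last coordinate is 0, the cone equation forces x = y = 0 by anisotropy; otherwise it
    determines the third coordinate. *)
Lemma dirK z : z \in cone3 F -> dir (undir z).1 (undir z).2 = z.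
Proof.
rewrite in_cone3 => /andP[]; rewrite [z]mk4_eta.
move: (lsubmx z 0 0) (lsubmx z 0 1) (rsubmx z 0 0) (rsubmx z 0 1) => x y a b.
rewrite qform_mk4 /undir !mk4E; case: ifPn => [/eqP->|b0] /= => [|/eqP q0 _].
  by rewrite mulr0 subr0 sum_sqr_eq0 // => /andP[/eqP-> /eqP->].
have -> : a = (x ^+ 2 + y ^+ 2) / b.
  by rewrite -[x ^+ 2 + _](subrK (a * b)) q0 add0r mulfK.
by congr mk4; field.
Qed.

Lemma undir_neq0 z : z \in cone3 F -> (undir z).1 != 0.
Proof. by move=> zS; rewrite -(dir_cone _ (undir z).2) dirK. Qed.

Lemma sum_cone3 (A : nmodType) (H : 'rV[F]_(2 + 2) -> A) :
  \sum_(z in cone3 F) H z = \sum_l \sum_(t | t != 0) H (dir t l).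
Proof.
rewrite exchange_big pair_big_dep /=.
rewrite (reindex_onto (fun p => dir p.1 p.2) undir) => [|z /dirK//].
apply: eq_bigl => -[t l] /=; rewrite dir_cone andbT.
by apply: andb_idr => t0; rewrite undirK.
Qed.

(* Minus twice the bilinear form of [dir 1 l] and [dir 1 l']. *)
Definition sep l l' : F :=
  match l, l' with
  | Some (x, y), Some (x', y') => (x - x') ^+ 2 + (y - y') ^+ 2
  | None, None => 0
  | _, _ => 1
  end.

(** Anisotropy of x^2 + y^2 keeps distinct isotropic lines from being orthogonal. *)
Lemma sep_eq0 l l' : (sep l l' == 0) = (l == l').
Proof.
case: l l' => [[x y]|] [[x' y']|] //=; rewrite ?oner_eq0 ?eqxx //.
by rewrite sum_sqr_eq0 // !subr_eq0.
Qed.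

Lemma qform_dirD t u l l' : qform (dir t l + dir u l') = - (t * u * sep l l').
Proof.
by case: l l' => [[x y]|] [[x' y']|] /=; rewrite mk4D qform_mk4; ring.
Qed.

Lemma qform_dirD_eq0 t u l l' : t != 0 -> u != 0 ->
  (qform (dir t l + dir u l') == 0) = (l == l').
Proof.
by move=> t0 u0; rewrite qform_dirD oppr_eq0 !mulf_eq0 (negPf t0) (negPf u0) sep_eq0.
Qed.

(* Twice the bilinear form of z and [dir 1 l]. *)
Definition pol z l : F :=
  if l is Some (x, y)
  then 2 * (lsubmx z 0 0 * x + lsubmx z 0 1 * y) - rsubmx z 0 0
       - rsubmx z 0 1 * (x ^+ 2 + y ^+ 2)
  else - rsubmx z 0 1.

(** Since [dir t l] is isotropic, no term in t^2 appears. *)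
Lemma qformB z t l : qform (z - dir t l) = qform z - t * pol z l.
Proof.
rewrite [z]mk4_eta; case: l => [[x y]|] /=; rewrite !mk4E mk4B !qform_mk4; ring.
Qed.

(** For b = 0 the lines orthogonal to z are [None] and q lines coded by an affine line of the plane;
    for b nonzero they are coded by a circle. *)
Lemma card_pol0 z : qform z != 0 -> #|[set l | pol z l == 0]| = #|F|.+1.
Proof.
have two0 := two_neq0 sqr_neqN1.
rewrite [z]mk4_eta.
move: (lsubmx z 0 0) (lsubmx z 0 1) (rsubmx z 0 0) (rsubmx z 0 1) => x y a b.
rewrite qform_mk4 => q0.
pose A := [set w | pol (mk4 x y a b) (Some w) == 0].
rewrite (cardsD1 None) !inE /= !mk4E oppr_eq0.
have -> : [set l | pol (mk4 x y a b) l == 0] :\ None = Some @: A.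
  apply/setP=> -[w|]; rewrite !inE /=; first by rewrite (mem_imset _ _ Some_inj) inE.
  by apply/esym/negP => /imsetP[].
rewrite (card_imset _ Some_inj).
case: (eqVneq b 0) q0 => [b_0|b0] /=.
  rewrite b_0 mulr0 subr0 sum_sqr_eq0 // add1n => xy0; congr _.+1.
  rewrite -(card_line (a / 2) xy0); apply: eq_card => -[v w].
  rewrite /A !inE /= !mk4E b_0 mul0r subr0 -[RHS](inj_eq (mulfI two0)) mulrCA divff //.
  by rewrite mulr1 subr_eq0.
move=> q0; rewrite add0n -(card_circle sqr_neqN1 q0).
(* Multiplying the equation [pol] = 0 by -b and completing the square gives (b v - x)^2 + (b w -
   y)^2 = x^2 + y^2 - a b. *)
pose h (w : F * F) := (b * w.1 - x, b * w.2 - y).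
have h_inj : injective h.
  by move=> [v w] [v' w'] [/addIr/(mulfI b0)-> /addIr/(mulfI b0)->].
rewrite -(card_imset A h_inj); congr #|pred_of_set _|; apply/setP => -[v w].
rewrite [RHS]inE /= -subr_eq0; apply/imsetP/idP => [[[v' w']]|vw].
  rewrite inE /= !mk4E => /eqP e [-> ->]; apply/eqP.
  by rewrite -[RHS](mulr0 (- b)) -e; ring.
exists ((v + x) / b, (w + y) / b); last by rewrite /h /=; congr pair; field.
rewrite inE /= !mk4E -(mulrI_eq0 _ (mulfI b0)) -oppr_eq0.
by rewrite -(eqP vw); apply/eqP; field.
Qed.

(** Isotropy of [z - dir t l] is an affine equation in t: each line not orthogonal to z gives one
    solution and the q + 1 orthogonal ones give none, which leaves q^2 + 1 - (q + 1). *)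
Lemma card_rep z : qform z != 0 ->
  #|[set a in cone3 F | z - a \in cone3 F]| = (#|F| ^ 2 - #|F|)%N.
Proof.
move=> q0; rewrite -sum1_card.
rewrite (eq_bigl (fun a => (a \in cone3 F) && (z - a \in cone3 F))); last first.
  by move=> a; rewrite inE.
rewrite big_mkcondr sum_cone3 /=.
rewrite (eq_bigr (fun l => (pol z l != 0) : nat)) => [|l _]; last first.
  rewrite -big_mkcondr /=; have [p0|p0] := eqVneq (pol z l) 0.
    rewrite big_pred0 // => t; rewrite in_cone3 qformB p0 mulr0 subr0 (negPf q0).
    by rewrite andbF.
  rewrite (eq_bigl (pred1 (qform z / pol z l))) ?big_pred1_eq // => t /=.
  rewrite in_cone3 qformB subr_eq0.
  rewrite -[t == _](inj_eq (mulIf p0)) divfK // [RHS]eq_sym.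
  (* The root is admissible: t = 0 or z = [dir t l] would make [qform z] vanish. *)
  have [e|] := eqVneq (qform z); rewrite ?andbF //=; apply/andP; split.
    by apply: contraNneq q0 => t0; rewrite e t0 mul0r.
  apply: contraNneq q0 => /eqP; rewrite subr_eq0 => /eqP ->.
  by rewrite -[dir t l]addr0 -(dir0 l) qform_dirD mulr0 mul0r oppr0.
rewrite -big_mkcond /= sum1dep_card.
have := card_pol0 q0; have := cardsC [set l | pol z l == 0].
rewrite card_option card_prod => /[swap] ->.
rewrite (_ : ~: _ = [set l | pol z l != 0]); last by apply/setP => l; rewrite !inE.
set k := #|[set _ | _]|; set m := #|F|; lia.
Qed.
End Cone.

(** * The sharp inequality for sums over lines *)

Section Modulus.
Variable R : realType.
Implicit Types (z : R[i]).

Lemma modulus_ge0 z : 0 <= modulus z.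
Proof. by case: z => a b; exact: sqrtr_ge0. Qed.

Lemma modulusM z z' : modulus (z * z') = modulus z * modulus z'.
Proof. exact: ComplexField.Normc.normcM. Qed.

Lemma modulus0 : modulus (0 : R[i]) = 0.
Proof. exact: ComplexField.Normc.normc0. Qed.

Lemma modulus_nat k : modulus (k%:R : R[i]) = k%:R.
Proof.
have -> : modulus (k%:R : R[i]) = modulus (1 : R[i]) *+ k.
  by rewrite /modulus -normcMn.
by rewrite /modulus ComplexField.Normc.normc1.
Qed.

Lemma modulus_sum (I : finType) (x : I -> R[i]) :
  modulus (\sum_i x i) <= \sum_i modulus (x i).
Proof.
elim/big_ind2: _ => [|z a z' b za z'b|//]; first by rewrite modulus0.
by apply: le_trans (lerD za z'b); exact: le_normcD.
Qed.

(** The variance identity: it records the exact loss in Cauchy-Schwarz, from which equality cases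
    are read off. *)
Lemma sum_dev (I : finType) (A : {pred I}) (a : I -> R) :
  #|A|%:R != 0 :> R ->
  \sum_(i in A) (a i - (\sum_(j in A) a j) / #|A|%:R) ^+ 2 =
  \sum_(i in A) a i ^+ 2 - (\sum_(i in A) a i) ^+ 2 / #|A|%:R.
Proof.
move=> A0; set s := \sum_(i in A) a i; set k := #|A|%:R in A0 *.
rewrite (eq_bigr (fun i => a i ^+ 2 - (2 * s / k) * a i + (s / k) ^+ 2)); last first.
  by move=> i _; ring.
rewrite big_split sumrB /= -mulr_sumr -/s sumr_const -[_ *+ _]mulr_natr -/k.
by field.
Qed.

Lemma sqr_sum_le (I : finType) (A : {pred I}) (a : I -> R) :
  (\sum_(i in A) a i) ^+ 2 <= #|A|%:R * \sum_(i in A) a i ^+ 2.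
Proof.
have [A0|A0] := eqVneq #|A| 0%N.
  by rewrite !big_pred0 ?expr0n ?mulr0 // => i; apply: card0_eq.
have k0 : 0 < #|A|%:R :> R by rewrite ltr0n lt0n.
rewrite mulrC -ler_pdivrMr // -subr_ge0 -sum_dev ?gt_eqF //.
by apply: sumr_ge0 => i _; exact: sqr_ge0.
Qed.

(** Triangle inequality and Cauchy-Schwarz on a set [A] that carries all nonzero terms. *)
Lemma sqr_modulus_sum_le (I : finType) (A : {set I}) (x : I -> R[i]) :
  (forall i, i \notin A -> x i = 0) ->
  modulus (\sum_i x i) ^+ 2 <= #|A|%:R * \sum_i modulus (x i) ^+ 2.
Proof.
move=> x0.
have trim (h : R -> R) : h 0 = 0 ->
    \sum_i h (modulus (x i)) = \sum_(i in A) h (modulus (x i)).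
  move=> h0; rewrite [RHS]big_mkcond; apply: eq_bigr => i _.
  by case: ifPn => // /x0 ->; rewrite modulus0.
rewrite (trim (fun y => y ^+ 2)) ?expr0n //.
apply: (le_trans _ (sqr_sum_le [in A] (fun i => modulus (x i)))) => /=.
rewrite -(trim id) // ler_pXn2r ?nnegrE ?modulus_ge0 ?modulus_sum //.
by apply: sumr_ge0 => i _; exact: modulus_ge0.
Qed.

Lemma sqr_modulus_sum_cst (I : finType) (A : {set I}) (x : I -> R[i]) c :
  (forall i, x i = if i \in A then c else 0) ->
  modulus (\sum_i x i) ^+ 2 = #|A|%:R * \sum_i modulus (x i) ^+ 2.
Proof.
move=> xc; rewrite (eq_bigr _ (fun i _ => xc i)) -big_mkcond sumr_const /=.
rewrite (eq_bigr (fun i => if i \in A then modulus c ^+ 2 else 0)); last first.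
  by move=> i _; rewrite xc; case: ifP; rewrite // modulus0 expr0n.
rewrite -big_mkcond sumr_const /= -[c *+ _]mulr_natr modulusM modulus_nat.
by rewrite -[X in _ * X]mulr_natr; ring.
Qed.

End Modulus.

(** * Optimization over the masses of the lines *)

Section LineSums.
Variables (R : realType) (L : finType) (Q : R).
Hypothesis Q_ge3 : 3 <= Q.
Hypothesis card_L : #|L|%:R = Q ^+ 2 + 1 :> R.
(* [mass l] and [refl l] are m_l and P_l in the introduction, and [refl2 l] is
   the sum of |f(a) f(-a)|^2 over a in l. *)
Variables mass refl refl2 : L -> R.
Hypothesis refl_ge0 : forall l, 0 <= refl l.
Hypothesis refl_le_mass : forall l, refl l <= mass l.
Hypothesis refl2_ge : forall l, refl l ^+ 2 / (Q - 1) <= refl2 l.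

Definition sharp_energy : R :=
  (Q ^+ 5 - 2 * Q ^+ 4 + 2 * Q ^+ 3 - 3 * Q + 3) / ((Q - 1) * (Q ^+ 2 + 1)).

(** The three terms bound the contributions of z = 0, of z on an isotropic line and of anisotropic
    z. *)
Definition line_bound : R :=
  (\sum_l refl l) ^+ 2 + (Q - 2) * \sum_l (mass l ^+ 2 - refl2 l)
  + (Q ^+ 2 - Q) * ((\sum_l mass l) ^+ 2 - \sum_l mass l ^+ 2).

(** With [refl2 l] replaced by its lower bound [refl l ^+ 2 / (Q - 1)], this is the increase of
    [line_bound] when every [refl l] is raised to [mass l]. *)
Definition reflection_deficit : R :=
  (\sum_l mass l) ^+ 2 - (\sum_l refl l) ^+ 2
  - (Q - 2) / (Q - 1) * \sum_l (mass l ^+ 2 - refl l ^+ 2).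

(** Minus the coefficient of sum_l m_l^2 after that replacement. *)
Definition line_coef : R := Q ^+ 2 - Q - (Q - 2) ^+ 2 / (Q - 1).

Lemma Q1_gt0 : 0 < Q - 1.
Proof. by rewrite subr_gt0 (lt_le_trans _ Q_ge3) // ltr1n. Qed.

Lemma Q2_gt0 : 0 < Q - 2.
Proof. by rewrite subr_gt0 (lt_le_trans _ Q_ge3) // ltr_nat. Qed.

Lemma line_coef_gt0 : 0 < line_coef.
Proof.
have Q1 := Q1_gt0.
have Q2 := Q2_gt0.
(* In powers of Q - 2 the numerator has only positive coefficients. *)
have -> : line_coef =
    ((Q - 2) ^+ 3 + 3 * (Q - 2) ^+ 2 + 5 * (Q - 2) + 2) / (Q - 1).
  by rewrite /line_coef; field; rewrite gt_eqF.
by rewrite divr_gt0 // !addr_gt0 ?mulr_gt0 ?exprn_gt0.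
Qed.

(** Writing M and P for the sums of m_l and P_l, (m_l - P_l) (m_l + P_l) <= (m_l - P_l) (M + P) sums
    to M^2 - P^2; the factor left is 1 - (Q - 2) / (Q - 1). *)
Lemma reflection_deficit_ge :
  ((\sum_l mass l) ^+ 2 - (\sum_l refl l) ^+ 2) / (Q - 1) <= reflection_deficit.
Proof.
have Q1 := Q1_gt0; set M := \sum_l mass l; set SP := \sum_l refl l.
have D : \sum_l (mass l ^+ 2 - refl l ^+ 2) <= M ^+ 2 - SP ^+ 2.
  rewrite subr_sqr /M /SP -sumrB mulr_suml; apply: ler_sum => l _.
  rewrite subr_sqr ler_wpM2l ?subr_ge0 //.
  apply: lerD; rewrite (bigD1 l) //= lerDl sumr_ge0 // => i _.
  exact: le_trans (refl_le_mass i).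
have k0 : 0 <= (Q - 2) / (Q - 1) by rewrite divr_ge0 ?ltW ?Q2_gt0.
have := ler_wpM2l k0 D; rewrite /reflection_deficit -/M -/SP.
suff -> : (M ^+ 2 - SP ^+ 2) / (Q - 1)
   = (M ^+ 2 - SP ^+ 2) - (Q - 2) / (Q - 1) * (M ^+ 2 - SP ^+ 2) by lra.
by field; rewrite gt_eqF.
Qed.

Lemma sum_refl_le_mass : \sum_l refl l <= \sum_l mass l.
Proof. exact: ler_sum. Qed.

Lemma reflection_deficit_ge0 : 0 <= reflection_deficit.
Proof.
apply: le_trans reflection_deficit_ge; apply: divr_ge0; last exact/ltW/Q1_gt0.
rewrite subr_ge0 ler_pXn2r ?nnegrE ?sum_refl_le_mass ?sumr_ge0 // => l _.
exact: le_trans (refl_le_mass l).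
Qed.

(** An exact identity whose right side has three nonnegative terms, so that it yields both the
    inequality and its equality case. *)
Lemma line_bound_deficit :
  sharp_energy * (\sum_l mass l) ^+ 2 - line_bound =
  reflection_deficit + (Q - 2) * \sum_l (refl2 l - refl l ^+ 2 / (Q - 1))
  + line_coef * \sum_(l in L) (mass l - (\sum_(l in L) mass l) / #|L|%:R) ^+ 2.
Proof.
have Q1 := Q1_gt0; have Q21 : 0 < Q ^+ 2 + 1 by nra.
rewrite sum_dev card_L ?gt_eqF // /line_bound /reflection_deficit.
rewrite !sumrB -mulr_suml /sharp_energy /line_coef /=.
set M := \sum_l mass l; set SP := \sum_l refl l; set m2 := \sum_l mass l ^+ 2.
set P2 := \sum_l _ ^+ 2; set SX := \sum_l refl2 l.
by field; rewrite !gt_eqF.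
Qed.

Lemma line_bound_le : line_bound <= sharp_energy * (\sum_l mass l) ^+ 2.
Proof.
rewrite -subr_ge0 line_bound_deficit; apply: addr_ge0.
  apply: addr_ge0; first exact: reflection_deficit_ge0.
  by rewrite pmulr_rge0 ?Q2_gt0 ?sumr_ge0 // => l _; rewrite subr_ge0.
by apply: mulr_ge0; [exact/ltW/line_coef_gt0|apply: sumr_ge0 => l _; exact: sqr_ge0].
Qed.

Lemma line_bound_eq : sharp_energy * (\sum_l mass l) ^+ 2 <= line_bound ->
  forall l, [/\ refl l = mass l, refl2 l = refl l ^+ 2 / (Q - 1)
              & mass l = (\sum_l mass l) / (Q ^+ 2 + 1)].
Proof.
rewrite -subr_le0 line_bound_deficit => le0.
have D1 := reflection_deficit_ge0; have Q2 := Q2_gt0.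
have D2l l : true -> 0 <= refl2 l - refl l ^+ 2 / (Q - 1) by rewrite subr_ge0.
have D2 : 0 <= \sum_l (refl2 l - refl l ^+ 2 / (Q - 1)) by apply: sumr_ge0.
pose dev l := (mass l - (\sum_(l in L) mass l) / #|L|%:R) ^+ 2.
have D3l l : l \in L -> 0 <= dev l by rewrite sqr_ge0.
have D3 : 0 <= \sum_(l in L) dev l by apply: sumr_ge0.
have c0 := line_coef_gt0.
have D2' : 0 <= (Q - 2) * \sum_l (refl2 l - refl l ^+ 2 / (Q - 1)) by rewrite pmulr_rge0.
have D3' : 0 <= line_coef * \sum_(l in L) dev l by apply: mulr_ge0 => //; exact: ltW.
have E1 : reflection_deficit <= 0 by move: le0 D2' D3'; rewrite /dev; lra.
have E2 : \sum_l (refl2 l - refl l ^+ 2 / (Q - 1)) = 0.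
  apply/eqP; rewrite eq_le D2 andbT -(pmulr_rle0 _ Q2).
  by move: le0 D3'; rewrite /dev; lra.
have E3 : \sum_(l in L) dev l = 0.
  apply/eqP; rewrite eq_le D3 andbT -(pmulr_rle0 _ c0).
  by move: le0; rewrite /dev; lra.
(* A zero deficit forces equal totals of [mass] and [refl], hence equality on each line. *)
have {E1} : (\sum_l mass l) ^+ 2 - (\sum_l refl l) ^+ 2 <= 0.
  have := le_trans reflection_deficit_ge E1.
  by rewrite pmulr_lle0 // invr_gt0 Q1_gt0.
have M0 : 0 <= \sum_l refl l by apply: sumr_ge0.
have MP := sum_refl_le_mass.
rewrite subr_le0 ler_pXn2r ?nnegrE ?(le_trans M0) // => PM.
have mP l : true -> 0 <= mass l - refl l by rewrite subr_ge0.
have E1 : \sum_l (mass l - refl l) = 0.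
  by rewrite sumrB; apply/eqP; rewrite subr_eq0 eq_le PM.
move=> l; split.
- by apply/esym/eqP; rewrite -subr_eq0; apply/eqP; exact: (psumr_eq0P mP E1).
- by apply/eqP; rewrite -subr_eq0; apply/eqP; exact: (psumr_eq0P D2l E2).
- have /eqP := psumr_eq0P D3l E3 (isT : l \in L).
  by rewrite sqrf_eq0 subr_eq0 card_L => /eqP.
Qed.

End LineSums.

(** * Additive energy of functions on the cone *)

Section Energy.
Variables (R : realType) (F : finFieldType).
Hypothesis sqr_neqN1 : forall x : F, x ^+ 2 != -1.
Local Notation V := 'rV[F]_(2 + 2).
Local Notation L := (option (F * F)).

Definition conv (f : V -> R[i]) (z : V) : R[i] := \sum_a f a * f (z - a).

Definition energy (f : V -> R[i]) : R := \sum_z modulus (conv f z) ^+ 2.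

(** The parameter t = 0 adds nothing; including it lets sums over t be shifted and reflected
    freely. *)
Lemma sum_supp_cone3 (A : nmodType) (H : V -> A) :
  (forall z, z \notin cone3 F -> H z = 0) ->
  \sum_z H z = \sum_l \sum_t H (dir t l).
Proof.
move=> H0; transitivity (\sum_(z in cone3 F) H z).
  by rewrite [RHS]big_mkcond; apply: eq_bigr => z _; case: ifPn => // /H0.
rewrite sum_cone3 //; apply: eq_bigr => l _; rewrite [RHS](bigD1 0) //=.
by rewrite H0 ?add0r // dir_cone eqxx.
Qed.

Let Q : R := #|F|%:R.

Lemma card_lines : #|{: L}|%:R = Q ^+ 2 + 1 :> R.
Proof. by rewrite card_option card_prod -natr1 natrM -expr2. Qed.

Lemma card_F_ge3 : 3 <= Q.
Proof.
have two0 := two_neq0 sqr_neqN1.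
have u : uniq [:: 0; 1; -1 : F].
  by rewrite /= !inE ![0 == _]eq_sym oppr_eq0 oner_eq0 -addr_eq0 (negPf two0).
by rewrite ler_nat -[3%N](card_uniqP u) max_card.
Qed.

(** * Energy of a function supported on the cone *)

Section Bound.
Variable f : V -> R[i].
Hypothesis f_supp : forall z, z \notin cone3 F -> f z = 0.

Let w z := modulus (f z) ^+ 2.
Let mass l := \sum_t w (dir t l).
Let refl l := \sum_t modulus (f (dir t l)) * modulus (f (dir (- t) l)).
Let refl2 l := \sum_t w (dir t l) * w (dir (- t) l).

Lemma f_dir0 l : f (dir 0 l) = 0.
Proof. by rewrite f_supp // dir_cone eqxx. Qed.

Lemma w_supp z : z \notin cone3 F -> w z = 0.
Proof. by move=> /f_supp fz; rewrite /w fz modulus0 expr0n. Qed.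

Lemma conv0 : conv f 0 = \sum_l \sum_t f (dir t l) * f (dir (- t) l).
Proof.
rewrite /conv sum_supp_cone3 => [|z /f_supp->]; last by rewrite mul0r.
by apply: eq_bigr => l _; apply: eq_bigr => t _; rewrite sub0r dirN.
Qed.

(** For a nonzero point a of another line, [dir s l - a] is a sum of points of two distinct lines,
    hence anisotropic, and f vanishes there. *)
Lemma conv_dir s l : s != 0 ->
  conv f (dir s l) = \sum_t f (dir t l) * f (dir (s - t) l).
Proof.
move=> s0; rewrite /conv sum_supp_cone3 => [|z /f_supp->]; last by rewrite mul0r.
rewrite (bigD1 l) //= [X in _ + X]big1 ?addr0.
  by apply: eq_bigr => t _; rewrite -dirN dirD.
move=> l' l'l; apply: big1 => t _.
have [->|t0] := eqVneq t 0; first by rewrite f_dir0 mul0r.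
rewrite [f (_ - _)]f_supp ?mulr0 // in_cone3 -dirN qform_dirD_eq0 ?oppr_eq0 //.
by rewrite eq_sym (negPf l'l).
Qed.

Lemma energy_split : energy f =
  modulus (conv f 0) ^+ 2
  + \sum_l \sum_(s | s != 0) modulus (conv f (dir s l)) ^+ 2
  + \sum_(z | qform z != 0) modulus (conv f z) ^+ 2.
Proof.
rewrite /energy (bigID (fun z => qform z == 0)) /=; congr (_ + _).
rewrite (bigD1 0) /=; last by rewrite -(dir0 None) qform_dir.
rewrite -(sum_cone3 sqr_neqN1 (fun z => modulus (conv f z) ^+ 2)); congr (_ + _).
by apply: eq_bigl => z; rewrite in_cone3.
Qed.

Lemma conv_anisotropic_le z : qform z != 0 ->
  modulus (conv f z) ^+ 2 <= (Q ^+ 2 - Q) * \sum_a w a * w (z - a).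
Proof.
move=> q0; apply: le_trans (@sqr_modulus_sum_le _ _
  [set a in cone3 F | z - a \in cone3 F] _ _) _.
  move=> a; rewrite inE negb_and => /orP[] /f_supp->; by rewrite ?mul0r ?mulr0.
rewrite card_rep // natrB ?natrX; last first.
  by rewrite -[leqLHS]expn1 leq_pexp2l // ltnW // finRing_gt1.
rewrite le_eqVlt; apply/orP; left; apply/eqP; congr (_ * _).
by apply: eq_bigr => a _; rewrite modulusM exprMn.
Qed.

(** The terms t = 0 and t = s vanish because f(0) = 0, which leaves q - 2 terms. *)
Lemma conv_dir_le s l : s != 0 ->
  modulus (conv f (dir s l)) ^+ 2 <=
  (Q - 2) * \sum_t w (dir t l) * w (dir (s - t) l).
Proof.
move=> s0; rewrite conv_dir //; apply: le_trans (@sqr_modulus_sum_le _ _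
  (~: [set 0; s]) _ _) _.
  move=> t; rewrite !inE negbK => /orP[] /eqP->; first by rewrite f_dir0 mul0r.
  by rewrite subrr f_dir0 mulr0.
have := cardsC [set 0; s]; rewrite cards2 eq_sym s0 /= => /(congr1 (fun n => n%:R : R)).
rewrite natrD -/Q => /(canRL (addKr _)) ->; rewrite addrC.
rewrite le_eqVlt; apply/orP; left; apply/eqP; congr (_ * _).
by apply: eq_bigr => a _; rewrite modulusM exprMn.
Qed.

Lemma sum_sqr_modulus_lines : \sum_z w z = \sum_l mass l.
Proof. exact/sum_supp_cone3/w_supp. Qed.

(** Two cone points have an anisotropic sum exactly when they lie on different lines, so the pairs
    on a common line are removed from all pairs. *)
Lemma sum_conv_anisotropic :
  \sum_(z | qform z != 0) \sum_a w a * w (z - a) =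
  (\sum_l mass l) ^+ 2 - \sum_l mass l ^+ 2.
Proof.
rewrite exchange_big /=.
transitivity (\sum_a w a * (\sum_(b | qform (a + b) != 0) w b)).
  apply: eq_bigr => a _; rewrite mulr_sumr [RHS](reindex (fun z => z - a)) /=.
    by apply: eq_big => [z|//]; rewrite subrKC.
  by exists (fun z => z + a) => z _; rewrite ?addrK ?subrK.
rewrite sum_supp_cone3 => [|z /w_supp->]; last by rewrite mul0r.
rewrite expr2 mulr_suml -sumrB; apply: eq_bigr => l _; rewrite -mulrBr mulr_suml.
apply: eq_bigr => t _; have [->|t0] := eqVneq t 0.
  by rewrite w_supp ?mul0r // dir_cone eqxx.
congr (_ * _); rewrite big_mkcond sum_supp_cone3 => [|z /w_supp->]; last by case: ifP.
rewrite (bigD1 l) //= [X in X + _]big1 => [|u _]; last first.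
  case: ifPn => //; rewrite dirD => /negP[].
  by rewrite qform_dir.
rewrite add0r [in RHS](bigD1 l) //= addrC addrK; apply: eq_bigr => l' l'l.
apply: eq_bigr => u _; have [->|u0] := eqVneq u 0.
  by rewrite w_supp ?if_same // dir_cone eqxx.
by rewrite qform_dirD_eq0 // eq_sym (negPf l'l).
Qed.

(** Over all s the sum is [mass l ^+ 2], and its term s = 0 is [refl2 l]. *)
Lemma sum_conv_dir l :
  \sum_(s | s != 0) \sum_t w (dir t l) * w (dir (s - t) l) = mass l ^+ 2 - refl2 l.
Proof.
have E : \sum_s \sum_t w (dir t l) * w (dir (s - t) l) = mass l ^+ 2.
  rewrite exchange_big expr2 mulr_suml; apply: eq_bigr => t _.
  rewrite mulr_sumr [RHS](reindex (fun s => s - t)) //.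
  by exists (fun s => s + t) => s _; rewrite ?addrK ?subrK.
apply/eqP; rewrite eq_sym subr_eq -E (bigD1 0) //= addrC; apply/eqP; congr (_ + _).
by apply: eq_bigr => t _; rewrite sub0r.
Qed.

Lemma energy_le_line_bound : energy f <= line_bound Q mass refl refl2.
Proof.
rewrite energy_split /line_bound; apply: lerD; first apply: lerD.
- rewrite conv0 ler_pXn2r ?nnegrE ?modulus_ge0 //.
    apply: le_trans (modulus_sum _) _; apply: ler_sum => l _.
    apply: le_trans (modulus_sum _) _; apply: ler_sum => t _.
    by rewrite modulusM.
  by apply: sumr_ge0 => l _; apply: sumr_ge0 => t _; rewrite mulr_ge0 ?modulus_ge0.
- rewrite mulr_sumr; apply: ler_sum => l _; rewrite -sum_conv_dir mulr_sumr.
  by apply: ler_sum => s; exact: conv_dir_le.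
- rewrite -sum_conv_anisotropic mulr_sumr; apply: ler_sum => z.
  exact: conv_anisotropic_le.
Qed.

(** This gives [refl l <= mass l], and |f(a)| = |f(-a)| in the case of equality. *)
Lemma sum_reflection l :
  \sum_t (modulus (f (dir t l)) - modulus (f (dir (- t) l))) ^+ 2 = 2 * (mass l - refl l).
Proof.
have E : mass l = \sum_t w (dir (- t) l).
  rewrite /mass (reindex (fun t : F => - t)) //.
  by exists (fun t => - t) => t _; rewrite opprK.
rewrite (eq_bigr (fun t => (w (dir t l) + w (dir (- t) l)) -
  2 * (modulus (f (dir t l)) * modulus (f (dir (- t) l))))); last first.
  by move=> t _; rewrite /w; ring.
by rewrite sumrB big_split -mulr_sumr /= -E -/(mass l) -/(refl l); ring.
Qed.

Lemma refl_le_mass l : refl l <= mass l.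
Proof.
rewrite -subr_ge0 -(pmulr_rge0 _ (ltr0n R 2)) -sum_reflection.
by apply: sumr_ge0 => t _; exact: sqr_ge0.
Qed.

Lemma refl_ge0 l : 0 <= refl l.
Proof. by apply: sumr_ge0 => t _; rewrite mulr_ge0 ?modulus_ge0. Qed.

Let a l t := modulus (f (dir t l)) * modulus (f (dir (- t) l)).

Lemma refl_nonzero l : refl l = \sum_(t in predC1 0) a l t.
Proof. by rewrite /refl (bigD1 0) //= f_dir0 modulus0 mul0r add0r. Qed.

Lemma refl2_nonzero l : refl2 l = \sum_(t in predC1 0) a l t ^+ 2.
Proof.
rewrite /refl2 (bigD1 0) //= /w f_dir0 modulus0 expr0n mul0r add0r.
by apply: eq_bigr => t _; rewrite -exprMn.
Qed.

Lemma card_nonzero : #|predC1 (0 : F)|%:R = Q - 1 :> R.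
Proof.
by rewrite cardC1 -subn1 natrB // ltnW // finRing_gt1.
Qed.

Lemma Q1_neq0 : Q - 1 != 0.
Proof. by rewrite gt_eqF // (Q1_gt0 card_F_ge3). Qed.

Lemma refl2_deviation l : \sum_(t in predC1 0) (a l t - refl l / (Q - 1)) ^+ 2 =
  refl2 l - refl l ^+ 2 / (Q - 1).
Proof.
by rewrite refl_nonzero refl2_nonzero -card_nonzero -sum_dev // card_nonzero Q1_neq0.
Qed.

Lemma refl2_ge l : refl l ^+ 2 / (Q - 1) <= refl2 l.
Proof. by rewrite -subr_ge0 -refl2_deviation sumr_ge0 // => t _; exact: sqr_ge0. Qed.

Lemma energy_le : energy f <= sharp_energy Q * (\sum_z w z) ^+ 2.
Proof.
apply: le_trans energy_le_line_bound _; rewrite sum_sqr_modulus_lines.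
exact: (line_bound_le card_F_ge3 card_lines refl_ge0 refl_le_mass refl2_ge).
Qed.

Lemma energy_eq : sharp_energy Q * (\sum_z w z) ^+ 2 <= energy f ->
  forall z, z \in cone3 F -> w z = (\sum_z w z) / (Q ^+ 2 + 1) / (Q - 1).
Proof.
rewrite sum_sqr_modulus_lines => /le_trans/(_ energy_le_line_bound) E z zS.
rewrite -(dirK sqr_neqN1 zS); move: (undir_neq0 sqr_neqN1 zS).
move: (undir z) => [t l] /= t0.
have [Pm Xl <-] := line_bound_eq card_F_ge3 card_lines refl_ge0 refl_le_mass refl2_ge E l.
(* Zero variance: |f(a) f(-a)| equals [refl l / (Q - 1)] at every point a of the line. *)
have := refl2_deviation l; rewrite Xl subrr => /psumr_eq0P/(_ t) => at_.
have /at_ : t \in predC1 0 by [].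
move=> /(_ (fun _ _ => sqr_ge0 _))/eqP; rewrite sqrf_eq0 subr_eq0 => /eqP at'.
(* Now |f(a)| = |f(-a)|, so |f(a)|^2 is that same constant. *)
have := sum_reflection l; rewrite Pm subrr mulr0 => /psumr_eq0P/(_ t isT).
move=> /(_ (fun _ _ => sqr_ge0 _))/eqP; rewrite sqrf_eq0 subr_eq0 => /eqP ft.
by rewrite /w expr2 {2}ft -Pm -at'.
Qed.

End Bound.

(** Each product f(a) f(z - a) is c^2 when both points lie on the cone and 0 otherwise, so no
    estimate loses anything. *)
Lemma energy_cst (f : V -> R[i]) c :
  (forall z, f z = if z \in cone3 F then c else 0) ->
  energy f = sharp_energy Q * (\sum_z modulus (f z) ^+ 2) ^+ 2.
Proof.
move=> fc.
have f_supp z : z \notin cone3 F -> f z = 0 by rewrite fc => /negPf->.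
have f_dir t l : f (dir t l) = if t \in predC1 0 then c else 0.
  by rewrite fc dir_cone.
have Q1 : Q - 1 != 0 by exact: Q1_neq0.
have Q2 : Q ^+ 2 + 1 != 0 by rewrite gt_eqF // ltr_wpDl ?sqr_ge0.
have sum_lines (x : R) : \sum_(l : L) x = (Q ^+ 2 + 1) * x.
  by rewrite sumr_const -mulr_natl card_lines.
have sum_t (x : R) : \sum_(t : F | t \in predC1 0) x = (Q - 1) * x.
  by rewrite sumr_const -mulr_natl card_nonzero.
set k := modulus c ^+ 2.
have mass_cst l : \sum_t modulus (f (dir t l)) ^+ 2 = (Q - 1) * k.
  rewrite -sum_t [RHS]big_mkcond; apply: eq_bigr => t _; rewrite f_dir.
  by case: ifP; rewrite // modulus0 expr0n.
have sum_mass : \sum_l \sum_t modulus (f (dir t l)) ^+ 2 = (Q ^+ 2 + 1) * ((Q - 1) * k).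
  by rewrite -sum_lines; apply: eq_bigr => l _; rewrite mass_cst.
have sum_mass2 : \sum_l (\sum_t modulus (f (dir t l)) ^+ 2) ^+ 2 =
    (Q ^+ 2 + 1) * ((Q - 1) * k) ^+ 2.
  by rewrite -sum_lines; apply: eq_bigr => l _; rewrite mass_cst.
rewrite sum_sqr_modulus_lines // sum_mass.
rewrite energy_split //.
have -> : modulus (conv f 0) ^+ 2 = ((Q ^+ 2 + 1) * ((Q - 1) * k)) ^+ 2.
  rewrite conv0 // (eq_bigr (fun=> c ^+ 2 * #|predC1 (0 : F)|%:R)) => [|l _].
    rewrite sumr_const -[_ *+ _]mulr_natr !modulusM !modulus_nat card_lines card_nonzero.
    by rewrite /k; ring.
  rewrite mulr_natr -sumr_const [RHS]big_mkcond; apply: eq_bigr => t _.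
  rewrite !f_dir !inE oppr_eq0; case: ifP => _; by rewrite ?mulr0.
rewrite (eq_bigr (fun=> (Q - 1) * ((Q - 2) ^+ 2 * k ^+ 2))) => [|l _]; last first.
  rewrite -sum_t; apply: eq_bigr => s s0; rewrite conv_dir //.
  rewrite (eq_bigr (fun t => if t \in ~: [set 0; s] then c ^+ 2 else 0)); last first.
    move=> t _; rewrite !f_dir !inE subr_eq0 negb_or ![s == _]eq_sym.
    by do 2!case: ifP => //=; rewrite ?mul0r ?mulr0.
  rewrite -big_mkcond sumr_const -[_ *+ _]mulr_natr modulusM modulus_nat.
  have := cardsC [set 0; s]; rewrite cards2 eq_sym s0 /=.
  move=> /(congr1 (fun n => n%:R : R)); rewrite natrD -/Q => /(canRL (addKr _)) ->.
  by rewrite !modulusM /k; ring.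
rewrite (eq_bigr (fun z => (Q ^+ 2 - Q) *
    \sum_a modulus (f a) ^+ 2 * modulus (f (z - a)) ^+ 2)) => [|z q0]; last first.
  have E a : f a * f (z - a) =
      if a \in [set a in cone3 F | z - a \in cone3 F] then c ^+ 2 else 0.
    by rewrite !fc !inE; do 2!case: ifP => //=; rewrite ?mul0r ?mulr0.
  rewrite (sqr_modulus_sum_cst E) card_rep // natrB ?natrX.
    by congr (_ * _); apply: eq_bigr => a _; rewrite modulusM exprMn.
  by rewrite -[leqLHS]expn1 leq_pexp2l // ltnW // finRing_gt1.
rewrite sum_lines -mulr_sumr; have /= -> := sum_conv_anisotropic f_supp.
rewrite sum_mass sum_mass2 /sharp_energy; field.
by rewrite -/Q Q2 Q1.
Qed.

End Energy.

(** * Parseval and the norms *)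

Section Parseval.
Variables (R : realType) (F : finFieldType) (e : F -> R[i]).
Hypothesis e_char : nontrivial_additive_character e.

Lemma char0 : e 0 = 1.
Proof.
case: e_char => eD e1 _; have := eD 0 0; rewrite addr0 => e00.
have e0 : e 0 != 0.
  apply/eqP => z; have /eqP := e1 0.
  by rewrite z modulus0 eq_sym oner_eq0.
by apply: (mulfI e0); rewrite mulr1.
Qed.

Lemma sqr_modulus (z : R[i]) : (modulus z ^+ 2)%:C = z * conjc z.
Proof. by rewrite -sqr_normc [(_ ^+ 2)%:C]rmorphXn; case: z. Qed.

Lemma conj_char a : conjc (e a) = e (- a).
Proof.
case: e_char => eD e1 _.
have ea : e a * e (- a) = 1 by rewrite -eD subrr char0.
have ea0 : e a != 0 by apply/eqP => z; have /eqP := ea; rewrite z mul0r eq_sym oner_eq0.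
by apply: (mulfI ea0); rewrite ea -sqr_modulus e1 expr1n.
Qed.

Lemma dotDl d (x y z : 'rV[F]_d) : dot (x + y) z = dot x z + dot y z.
Proof.
by rewrite /dot -big_split; apply: eq_bigr => i _; rewrite /= mxE mulrDl.
Qed.

Lemma dotDr d (x y z : 'rV[F]_d) : dot x (y + z) = dot x y + dot x z.
Proof.
by rewrite /dot -big_split; apply: eq_bigr => i _; rewrite /= mxE mulrDr.
Qed.

Lemma dotNr d (x z : 'rV[F]_d) : dot x (- z) = - dot x z.
Proof.
by rewrite /dot -sumrN; apply: eq_bigr => i _; rewrite /= mxE mulrN.
Qed.

(** For nonzero z, translation by an [x0] with [dot x0 z = a] multiplies the sum by [e a], which is
    not 1. *)
Lemma char_orthogonality d (z : 'rV[F]_d) :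
  \sum_(x : 'rV[F]_d) e (dot x z) = (z == 0)%:R * (#|F| ^ d)%:R.
Proof.
have [->|z0] := eqVneq z 0.
  rewrite mul1r (eq_bigr (fun=> 1)) => [|x _]; last first.
    by rewrite /dot big1 ?char0 // => i _; rewrite mxE mulr0.
  by rewrite sumr_const card_mx mul1n.
case: e_char => eD _ [a ea]; rewrite mul0r.
have [i zi] : exists i, z 0 i != 0.
  apply/existsP; apply: contraNT z0; rewrite negb_exists => /forallP z0.
  by apply/eqP/rowP => i; rewrite mxE; apply/eqP; rewrite -[_ == _]negbK.
pose x0 : 'rV[F]_d := \row_j (if j == i then a / z 0 i else 0).
have x0z : dot x0 z = a.
  rewrite /dot (bigD1 i) //= big1 => [|j ji]; rewrite mxE ?eqxx ?(negPf ji) ?mul0r //.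
  by rewrite addr0 divfK.
set s := \sum_x _.
have : s * (e a - 1) = 0.
  rewrite mulrBr mulr1 {2}/s (reindex (fun x => x + x0)) /=; last first.
    by exists (fun x => x - x0) => x _; rewrite ?addrK ?subrK.
  by rewrite mulr_suml -sumrB big1 // => x _; rewrite dotDl eD x0z subrr.
by move/eqP; rewrite mulf_eq0 subr_eq0 (negPf ea) orbF => /eqP.
Qed.

(** Expand the squared modulus and sum over x first; orthogonality leaves the diagonal. *)
Lemma parseval d (A : 'rV[F]_d -> R[i]) :
  \sum_(x : 'rV[F]_d) modulus (\sum_z A z * e (dot x z)) ^+ 2 =
  (#|F| ^ d)%:R * \sum_z modulus (A z) ^+ 2.
Proof.
case: e_char => eD _ _; apply: complexI.
have conjM (a b : R[i]) : conjc (a * b) = conjc a * conjc b by exact: rmorphM.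
rewrite rmorphM rmorph_nat !rmorph_sum /=.
under eq_bigr => x _ do rewrite sqr_modulus rmorph_sum /= mulr_suml.
rewrite exchange_big mulr_sumr /=; apply: eq_bigr => z _.
under eq_bigr => x _ do rewrite mulr_sumr.
rewrite exchange_big /= (bigD1 z) //= [X in _ + X]big1 ?addr0 => [|z' z'z].
  rewrite (eq_bigr (fun=> (modulus (A z) ^+ 2)%:C)) => [|x _].
    by rewrite sumr_const card_mx mul1n -[LHS]mulr_natl.
  rewrite sqr_modulus conjM conj_char mulrACA -eD -dotNr -dotDr subrr.
  by rewrite /dot big1 ?char0 ?mulr1 // => i _; rewrite mxE mulr0.
rewrite (eq_bigr (fun x => A z * conjc (A z') * e (dot x (z - z')))) => [|x _].
  by rewrite -mulr_sumr char_orthogonality subr_eq0 eq_sym (negPf z'z) mul0r mulr0.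
by rewrite conjM conj_char mulrACA -eD -dotNr -dotDr.
Qed.

(** The square of the transform of f is the transform of [conv f], to which Parseval applies. *)
Lemma parseval_conv (f : 'rV[F]_(2 + 2) -> R[i]) :
  \sum_(x : 'rV[F]_(2 + 2)) modulus (\sum_z f z * e (dot x z)) ^+ 4 =
  #|F|%:R ^+ 4 * energy f.
Proof.
case: e_char => eD _ _; rewrite -natrX -parseval; apply: eq_bigr => x _.
rewrite (exprM _ 2 2) [X in X ^+ 2 = _]expr2 -modulusM; congr (modulus _ ^+ 2).
rewrite mulr_suml.
transitivity (\sum_a \sum_z f a * f (z - a) * e (dot x z)).
  apply: eq_bigr => a _; rewrite mulr_sumr (reindex (fun z => z - a)) /=.
    by apply: eq_bigr => z _; rewrite mulrACA -eD -dotDr subrKC.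
  by exists (fun z => z + a) => z _; rewrite ?addrK ?subrK.
by rewrite exchange_big; apply: eq_bigr => z _; rewrite /conv mulr_suml.
Qed.

End Parseval.

(** * Extension by zero and powers of the norms *)

Section ZeroExtension.
Variables (R : realType) (F : finFieldType) (d : nat) (S : {set 'rV[F]_d}).
Variable f : {xi | xi \in S} -> R[i].

Definition zero_ext (z : 'rV[F]_d) : R[i] := oapp f 0 (insub z).

Lemma zero_ext_val xi : zero_ext (val xi) = f xi.
Proof. by rewrite /zero_ext valK. Qed.

Lemma zero_ext_out z : z \notin S -> zero_ext z = 0.
Proof. by move=> zS; rewrite /zero_ext insubN. Qed.

Lemma sum_zero_ext (A : nmodType) (G : R[i] -> 'rV[F]_d -> A) :
  (forall z, G 0 z = 0) ->
  \sum_(xi : {xi | xi \in S}) G (f xi) (val xi) = \sum_z G (zero_ext z) z.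
Proof.
move=> G0; rewrite [RHS](bigID [in S]) /= [X in _ + X]big1 ?addr0; last first.
  by move=> z /zero_ext_out->.
rewrite (big_sub [in S]) /=; apply: eq_bigr => xi _; rewrite -zero_ext_val.
by [].
Qed.

Lemma extensionE (e : F -> R[i]) x :
  extension e f x = #|S|%:R^-1 * \sum_z zero_ext z * e (dot x z).
Proof.
congr (_ * _); rewrite (sum_zero_ext (G := fun y z => y * e (dot x z))) // => z.
exact: mul0r.
Qed.

End ZeroExtension.

Lemma powR_natK (R : realType) (x : R) k : (0 < k)%N -> 0 <= x ->
  (x `^ k%:R^-1) ^+ k = x.
Proof.
move=> k0 x0; rewrite -powR_mulrn ?powR_ge0 // -powRrM mulVf ?powRr1 //.
by rewrite pnatr_eq0 -lt0n.
Qed.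

Lemma counting_normX (R : realType) (F : finFieldType) (d k : nat)
    (g : 'rV[F]_d -> R[i]) : (0 < k)%N ->
  counting_norm k%:R g ^+ k = \sum_x modulus (g x) ^+ k.
Proof.
move=> k0; rewrite /counting_norm powR_natK ?sumr_ge0 // => [|x _]; last exact: powR_ge0.
by apply: eq_bigr => x _; rewrite powR_mulrn ?modulus_ge0.
Qed.

Lemma surface_normX (R : realType) (F : finFieldType) (d : nat)
    (S : {set 'rV[F]_d}) (k : nat) (f : {xi | xi \in S} -> R[i]) : (0 < k)%N ->
  surface_norm k%:R f ^+ k = #|S|%:R^-1 * \sum_z modulus (zero_ext f z) ^+ k.
Proof.
move=> k0; rewrite /surface_norm powR_natK //; last first.
  by rewrite mulr_ge0 ?invr_ge0 ?ler0n ?sumr_ge0 // => xi _; exact: powR_ge0.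
congr (_ * _); rewrite -(sum_zero_ext f (G := fun y _ => modulus y ^+ k)).
  by apply: eq_bigr => xi _; rewrite powR_mulrn ?modulus_ge0.
by move=> z; rewrite modulus0 expr0n gtn_eqF.
Qed.

(** If x^2 = -1 and q = 4 k + 3, then x = x^q = x^3 = -x; but x = 0 is absurd, and 2 = 0 contradicts
    q 1 = 0 with q odd. *)
Lemma sqr_neqN1_mod4 (F : finFieldType) : (#|F| %% 4 = 3)%N ->
  forall x : F, x ^+ 2 != -1.
Proof.
move=> q4 x; apply/eqP => x2.
have := expf_card x; rewrite (divn_eq #|F| 4) q4 exprD mulnC !exprM.
rewrite (exprM x 2 2) x2 sqrrN !expr1n mul1r exprS x2 mulrN1 => /eqP.
rewrite eq_sym -addr_eq0 -mulr2n -mulr_natr mulf_eq0 => /orP[/eqP x0|/eqP two0].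
  by move: x2; rewrite x0 expr0n /= => /eqP; rewrite eq_sym oppr_eq0 oner_eq0.
have := expg_cardG (finset.in_setT (1 : F)); rewrite cardsT FinRing.zmodXgE.
rewrite (divn_eq #|F| 4) q4 => /eqP; rewrite -mulr_natl natrD natrM mulr1.
rewrite (natrM F 2 2) (natrD F 2 1) two0 !(mulr0, add0r) => /eqP.
by move/eqP; rewrite oner_eq0.
Qed.

Lemma inf_min (R : realType) (E : set R) (x : R) :
  E x -> (forall y, E y -> x <= y) -> inf E = x.
Proof.
move=> Ex xmin; apply/eqP; rewrite eq_le; apply/andP; split.
  by apply: ge_inf => //; exists x => y /xmin.
by apply: lb_le_inf; [exists x|].
Qed.

Theorem theorem1p5 (R : realType) (p n q : nat) (F : finFieldType)
    (e : F -> R[i])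
    (p_prime : prime p) (p_odd : odd p) (q_def : q = (p ^ n)%N)
    (q_mod4 : (q %% 4 = 3)%N) (card_F : #|F| = q)
    (e_char : nontrivial_additive_character e) :
  let Q : R := q%:R in
  let K : R := Q ^+ 4 * (Q ^+ 5 - 2 * Q ^+ 4 + 2 * Q ^+ 3 - 3 * Q + 3)
               / ((Q - 1) ^+ 3 * (Q ^+ 2 + 1) ^+ 3) in
  [/\ best_constant e (cone3 F) 2 4 =
        (1 - 2 * Q ^- 1 + 2 * Q ^- 2 - 3 * Q ^- 4 + 3 * Q ^- 5) `^ (1 / 4)
        * (1 - Q ^- 1) `^ (- (3 / 4)) * (1 + Q ^- 2) `^ (- (3 / 4)),
      forall f : {xi | xi \in cone3 F} -> R[i],
        counting_norm 4 (extension e f) ^+ 4 <= K * surface_norm 2 f ^+ 4,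
      forall K' : R,
        (forall f : {xi | xi \in cone3 F} -> R[i],
          counting_norm 4 (extension e f) ^+ 4 <= K' * surface_norm 2 f ^+ 4) ->
        K <= K',
      forall (f : {xi | xi \in cone3 F} -> R[i]) (c : R[i]),
        (forall xi, f xi = c) ->
        counting_norm 4 (extension e f) ^+ 4 = K * surface_norm 2 f ^+ 4
    & forall f : {xi | xi \in cone3 F} -> R[i],
        maximizer e 2 4 f ->
        exists c : R, forall xi, modulus (f xi) = c].
Proof.
move=> Q K.
have nsq : forall x : F, x ^+ 2 != -1 by apply: sqr_neqN1_mod4; rewrite card_F.
have QF : #|F|%:R = Q by rewrite card_F.
have Q3 : 3 <= Q by rewrite -QF card_F_ge3.
have Q1 : 0 < Q - 1 := Q1_gt0 Q3.
have Q0 : 0 < Q by apply: lt_le_trans Q3; rewrite ltr0n.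
have Q21 : 0 < Q ^+ 2 + 1 by rewrite ltr_wpDl ?sqr_ge0.
pose N : R := (Q - 1) * (Q ^+ 2 + 1).
have N0 : 0 < N by rewrite mulr_gt0.
have cardS : #|cone3 F|%:R = N.
  rewrite -sum1_card natr_sum sum_cone3 // (eq_bigr (fun=> Q - 1)) => [|l _].
    by rewrite sumr_const -[LHS]mulr_natl card_lines QF mulrC.
  rewrite sumr_const -QF -card_nonzero; congr (_%:R).
pose num : R := Q ^+ 5 - 2 * Q ^+ 4 + 2 * Q ^+ 3 - 3 * Q + 3.
(* Parseval and the normalized extension give [Q ^+ 4 / N ^+ 4]; the fourth power of the normalized
   L^2 norm takes back [N ^+ 2]. *)
have KE : K = Q ^+ 4 / N ^+ 2 * sharp_energy Q.
  by rewrite /K /sharp_energy /N; field; rewrite !gt_eqF.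
pose S2 (f : {xi | xi \in cone3 F} -> R[i]) := \sum_z modulus (zero_ext f z) ^+ 2.
have count4 (f : {xi | xi \in cone3 F} -> R[i]) : counting_norm 4 (extension e f) ^+ 4 =
    Q ^+ 4 / N ^+ 4 * energy (zero_ext f).
  rewrite (counting_normX (k := 4)) //.
  under eq_bigr => x _ do rewrite extensionE modulusM exprMn.
  rewrite -mulr_sumr parseval_conv // QF mulrA; congr (_ * _); rewrite mulrC.
  have -> : modulus (#|cone3 F|%:R^-1 : R[i]) = N^-1.
    by rewrite /modulus ComplexField.Normc.normcV -/(modulus _) modulus_nat cardS.
  by rewrite exprVn.
have surf4 (f : {xi | xi \in cone3 F} -> R[i]) : surface_norm 2 f ^+ 4 = (S2 f / N) ^+ 2.
  by rewrite (exprM _ 2 2) (surface_normX (k := 2)) // cardS mulrC.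
have KS (f : {xi | xi \in cone3 F} -> R[i]) : K * surface_norm 2 f ^+ 4 =
    Q ^+ 4 / N ^+ 4 * (sharp_energy Q * S2 f ^+ 2).
  by rewrite KE surf4; field; rewrite gt_eqF.
have Cpos : 0 < Q ^+ 4 / N ^+ 4 by rewrite divr_gt0 ?exprn_gt0.
have supp := @zero_ext_out R F _ (cone3 F).
have upper (f : {xi | xi \in cone3 F} -> R[i]) :
    counting_norm 4 (extension e f) ^+ 4 <= K * surface_norm 2 f ^+ 4.
  by rewrite count4 KS ler_pM2l // -QF; exact: (energy_le nsq (supp f)).
have cst (f : {xi | xi \in cone3 F} -> R[i]) c : (forall xi, f xi = c) ->
    counting_norm 4 (extension e f) ^+ 4 = K * surface_norm 2 f ^+ 4.
  move=> fc; rewrite count4 KS; congr (_ * _); rewrite -QF.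
  apply: (energy_cst nsq (c := c)).
  move=> z; case: ifPn => [zS|/supp//].
  by rewrite -[z]/(val (Sub z zS : {xi | xi \in cone3 F})) zero_ext_val.
(* A test function of norm 1 that attains equality; it shows that neither [K] nor its fourth root
   can be lowered. *)
pose one_ (xi : {xi | xi \in cone3 F}) : R[i] := 1.
have surf1 : surface_norm 2 one_ = 1.
  rewrite /surface_norm (eq_bigr (fun=> 1)) => [|xi _]; last first.
    by rewrite /modulus ComplexField.Normc.normc1 powR1.
  by rewrite sumr_const card_sig mulVf ?powR1 // cardS gt_eqF.
have num0 : 0 < num.
  have Q2 : 0 < Q - 2 := Q2_gt0 Q3.
  have -> : num = Q ^+ 4 * (Q - 2) + Q * (2 * Q ^+ 2 - 3) + 3 by rewrite /num; ring.
  have Q2_3 : 0 < 2 * Q ^+ 2 - 3 by nra.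
  by rewrite !addr_gt0 ?mulr_gt0 ?exprn_gt0.
have K0 : 0 < K.
  by rewrite /K divr_gt0 // ?mulr_gt0 ?exprn_gt0.
have count0 (f : {xi | xi \in cone3 F} -> R[i]) :
    0 <= counting_norm 4 (extension e f) by exact: powR_ge0.
have surf0 (f : {xi | xi \in cone3 F} -> R[i]) : 0 <= surface_norm 2 f by exact: powR_ge0.
pose B := K `^ 4^-1.
have B4 : B ^+ 4 = K by rewrite /B (powR_natK (k := 4)) // ltW.
have B0 : 0 <= B by exact: powR_ge0.
have best : best_constant e (cone3 F) 2 4 = B.
  apply: inf_min => /= [f|C].
    rewrite -(ler_pXn2r (n := 4)) ?nnegrE ?mulr_ge0 // exprMn B4; exact: upper.
  move=> /(_ one_); rewrite surf1 mulr1; apply: le_trans.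
  rewrite -(ler_pXn2r (n := 4)) ?nnegrE // B4 (cst one_ 1) // surf1 expr1n mulr1 //.
split => //.
- have b0 : 0 <= 1 - Q ^- 1 by rewrite subr_ge0 invf_le1 //; lra.
  have c0 : 0 <= 1 + Q ^- 2 by rewrite addr_ge0 ?invr_ge0 ?sqr_ge0.
  (* All factors become fourth roots, so that they merge into the fourth root of [K]. *)
  have pw x : 0 <= x -> x `^ (- (3 / 4)) = (x ^- 3) `^ 4^-1 :> R.
    by move=> x0; rewrite -mulNr powRrM powR_invn.
  have a0 : 0 <= 1 - 2 * Q ^- 1 + 2 * Q ^- 2 - 3 * Q ^- 4 + 3 * Q ^- 5.
    have -> : 1 - 2 * Q ^- 1 + 2 * Q ^- 2 - 3 * Q ^- 4 + 3 * Q ^- 5 = num / Q ^+ 5.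
      by rewrite /num; field; rewrite gt_eqF.
    by rewrite divr_ge0 ?exprn_ge0 // ltW.
  rewrite best /B div1r !pw // -!powRM ?mulr_ge0 ?invr_ge0 ?exprn_ge0 //.
  by congr (_ `^ _); rewrite /K; field; rewrite !gt_eqF.
- by move=> K' /(_ one_); rewrite (cst one_ 1) // surf1 expr1n !mulr1.
(* The witness is the square root of the value of |f|^2 that [energy_eq] provides. *)
- move=> f [_ max_f]; exists (Num.sqrt (S2 f / (Q ^+ 2 + 1) / (Q - 1))) => xi.
  have E : energy (zero_ext f) = sharp_energy Q * S2 f ^+ 2.
    apply: (mulfI (lt0r_neq0 Cpos)); rewrite -count4 -KS max_f best exprMn B4.
    by [].
  have := @energy_eq R F nsq _ (supp f); rewrite QF -/(S2 f) -E lexx.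
  move=> /(_ isT _ (valP xi)); rewrite zero_ext_val => <-.
  by rewrite sqrtr_sqr ger0_norm ?modulus_ge0.
Qed.
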